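(* Let $n\ge1$, let $\lambda=(\lambda_1,\dots,\lambda_n)$ be a partition of length at most $n$ with bottom partition $\lambda^{(0)}=(\lambda_2,\dots,\lambda_n)$, let $0<a<b$, and let $(B^n_{0,\lambda},\dots,B^n_{n,\lambda})$ be the Chebyshev-Bernstein basis of the Müntz space $\mathcal{E}_\lambda(n)$ over $[a,b]$. Then for $k=0,\dots,n$, $$\left(B^n_{k,\lambda}\right)^{(k)}(a)=\frac{n!\;a^{\lambda_1}}{(n-k)!\,(b-a)^k}\,\frac{f_\lambda(n+1)}{f_{\lambda^{(0)}}(n)}\,\frac{S_{\lambda^{(0)}}(a^{n-k},b^k)}{S_\lambda(a^{n+1-k},b^k)}$$ and $$\left(B^n_{k,\lambda}\right)^{(n-k)}(b)=(-1)^{n-k}\frac{n!\;b^{\lambda_1}}{k!\,(b-a)^{n-k}}\,\frac{f_\lambda(n+1)}{f_{\lambda^{(0)}}(n)}\,\frac{S_{\lambda^{(0)}}(a^{n-k},b^k)}{S_\lambda(a^{n-k},b^{k+1})},$$ where the superscripts $(k)$ and $(n-k)$ on the functions denote derivatives of that order.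
   Context: Partitions and Schur functions: a partition of length at most $n$ is a sequence of integers $\lambda_1\ge\dots\ge\lambda_n\ge0$; partitions differing only by trailing zeros are identified. For a partition $\mu$ of length at most $m$, $S_\mu(u_1,\dots,u_m)=\det(u_i^{\mu_j+m-j})_{1\le i,j\le m}/\det(u_i^{m-j})_{1\le i,j\le m}$ is the Schur polynomial (evaluated also at coinciding arguments). The notation $S_\mu(x^p,y^q)$ means that $x$ is repeated $p$ times and $y$ is repeated $q$ times. $f_\mu(m)=S_\mu(1^m)$ is the number of semi-standard Young tableaux of shape $\mu$ with entries at most $m$; $f_\emptyset(m)=1$. Müntz space: $\mathcal{E}_\lambda(n)$ is the span on $]0,\infty[$ of $1,t^{\lambda_1-\lambda_2+1},t^{\lambda_1-\lambda_3+2},\dots,t^{\lambda_1-\lambda_n+(n-1)},t^{\lambda_1+n}$. Chebyshev-Bernstein basis of $\mathcal{E}_\lambda(n)$ over $[a,b]\subset\,]0,\infty[$: the unique basis $(B_0,\dots,B_n)$ of $\mathcal{E}_\lambda(n)$ with $\sum_{k}B_k=1$ such that, for each $k$, $B_k$ vanishes $k$ times at $a$ and $n-k$ times at $b$ (counting multiplicity). *)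

(* Defs.v *)
From mathcomp Require Import all_boot all_order all_algebra.
From mathcomp Require Import perm.
From mathcomp Require Import all_classical all_reals all_analysis.
From mathcomp Require mpoly.
(* The notations of mpoly clash with those of mathcomp-analysis, so only its
   canonical instances are imported. *)
Import (canonicals) mpoly.
Import numFieldNormedType.Exports.

Set Implicit Arguments.
Unset Strict Implicit.
Unset Printing Implicit Defensive.

Import Order.TTheory GRing.Theory Num.Theory.

Local Open Scope ring_scope.

(* A partition of length at most n is a nonincreasing [mu : seq nat] with
   [size mu <= n]; its (j+1)-st part is [nth 0 mu j], so that partitions
   differing only by trailing zeros behave alike. *)

Section Alternant.
Variable A : comNzRingType.

(* det (u_i ^ (mu_j + m - j)), 1 <= i, j <= m; the indices are shifted by one
   here. For [mu = [::]] this is det (u_i ^ (m - j)). *)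
Definition alternant (m : nat) (u : 'I_m -> A) (mu : seq nat) : A :=
  \det (\matrix_(i < m, j < m) u i ^+ (nth 0%N mu j + (m - j.+1))).

(* Reduce each X ^ (mu_j + m - j) modulo the monic polynomial \prod_i (X - u_i)
   and evaluate the remainder at the u_i. *)
Lemma alternant_dvd (m : nat) (u : 'I_m -> A) (mu : seq nat) :
  exists p : A, p * alternant u [::] = alternant u mu.
Proof.
pose P := \prod_(i < m) ('X - (u i)%:P).
have Pmon : P \is monic by apply: monic_prod => i _; exact: monicXsubC.
have szP : size P = m.+1.
  by rewrite size_prod_XsubC -[index_enum _]enumT size_enum_ord.
pose r N := Pdiv.Ring.rmodp ('X^N) P.
have rE i N : u i ^+ N = \sum_(l < m) u i ^+ l * (r N)`_l.
  have Pi : P.[u i] = 0.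
    by rewrite horner_prod (bigD1 i) //= hornerXsubC subrr mul0r.
  have szr : (size (r N) <= m)%N.
    by rewrite -ltnS -szP Pdiv.Ring.ltn_rmodpN0 // monic_neq0.
  rewrite -[LHS]hornerXn (Pdiv.RingMonic.rdivp_eq Pmon 'X^N).
  rewrite hornerD hornerM Pi mulr0 add0r -/(r N) (horner_coef_wide _ szr).
  by apply: eq_bigr => l _; rewrite mulrC.
exists (\det (\matrix_(l < m, j < m)
               (r (nth 0%N mu j + (m - j.+1))%N)`_(m - l.+1))).
rewrite mulrC -det_mulmx; congr (\det _).
apply/matrixP => i j; rewrite !mxE [RHS]rE.
rewrite (reindex_inj rev_ord_inj) /=; apply: eq_bigr => l _.
have e : (m - (rev_ord l).+1)%N = l by exact: (congr1 val (rev_ordK l)).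
by rewrite !mxE nth_nil add0n e.
Qed.

Lemma alternant_nil (m : nat) (u : 'I_m -> A) :
  alternant u [::] = \prod_(i < m) \prod_(j < m | (i < j)%N)
                       (u (rev_ord j) - u (rev_ord i)).
Proof.
pose v : 'rV[A]_m := \row_j u (rev_ord j).
transitivity (\det (Vandermonde m v)); last first.
  rewrite det_Vandermonde; apply: eq_bigr => i _; apply: eq_bigr => j _.
  by rewrite !mxE.
pose s : {perm 'I_m} := perm (@rev_ord_inj m).
have -> : alternant u [::] = \det (row_perm s (col_perm s (Vandermonde m v)^T)).
  congr (\det _); apply/matrixP => i j; rewrite !mxE !permE nth_nil add0n.
  by rewrite rev_ordK.
rewrite row_permE col_permE !det_mulmx [X in _ * X]mulrC mulrA.
by rewrite !det_perm -signr_addb odd_permV addbb mul1r det_tr.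
Qed.

End Alternant.

Section Schur.
Variable R : idomainType.

(* The variables u_1, ..., u_m of R[u_1, ..., u_m] *)
Definition mvar (m : nat) (i : 'I_m) : mpoly.mpoly m R :=
  mpoly.mpolyX R (mpoly.mnm1 i).

Lemma alternant_mvar_neq0 (m : nat) : alternant (@mvar m) [::] != 0.
Proof.
rewrite alternant_nil; apply/prodf_neq0 => i _; apply/prodf_neq0 => j ij.
rewrite subr_eq0; apply/eqP.
move=> /(congr1 (mpoly.mcoeff (mpoly.mnm1 (rev_ord j)))).
rewrite !mpoly.mcoeffXU eqxx (inj_eq rev_ord_inj).
by rewrite -val_eqE /= (ltn_eqF ij) => /eqP; rewrite oner_eq0.
Qed.

Lemma schur_subproof (m : nat) (mu : seq nat) :
  exists p, p * alternant (@mvar m) [::] == alternant (@mvar m) mu.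
Proof. by have [p <-] := alternant_dvd (@mvar m) mu; exists p. Qed.

(* The quotient of the two determinants, taken in the polynomial ring so that
   it can be evaluated at coinciding arguments; [alternant_mvar_neq0] makes it
   unique. *)
Definition schur (m : nat) (mu : seq nat) : mpoly.mpoly m R :=
  xchoose (schur_subproof m mu).

Lemma schurE (m : nat) (mu : seq nat) :
  schur m mu * alternant (@mvar m) [::] = alternant (@mvar m) mu.
Proof. exact/eqP/(xchooseP (schur_subproof m mu)). Qed.

(* S_mu (u_1, ..., u_m), with [us] the sequence of the u_i. *)
Definition schur_at (mu : seq nat) (us : seq R) : R :=
  mpoly.meval (fun i => nth 0 us i) (schur (size us) mu).

(* S_mu (x^p, y^q) *)
Definition schur2 (mu : seq nat) (x : R) (p : nat) (y : R) (q : nat) : R :=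
  schur_at mu (nseq p x ++ nseq q y).

(* f_mu (m) = S_mu (1^m), as an element of R *)
Definition schur1 (mu : seq nat) (m : nat) : R := schur_at mu (nseq m 1).

End Schur.

Section MuntzSpace.
Variable R : realType.

(* Real functions are total; a function on ]0, +oo[ is represented by any
   extension, and only its values at positive points are constrained. *)
Definition fspan (m : nat) (g : 'I_m -> R -> R) : set (R -> R) :=
  [set f | exists c : 'I_m -> R,
     forall t, 0 < t -> f t = \sum_(j < m) c j * g j t].

Definition ffree (m : nat) (g : 'I_m -> R -> R) : Prop :=
  forall c : 'I_m -> R,
    (forall t, 0 < t -> \sum_(j < m) c j * g j t = 0) -> forall j, c j = 0.

(* lambda_1 - lambda_(j+1) + j, with lambda_(n+1) = 0: the value is 0 at j = 0
   and lambda_1 + n at j = n. The truncated subtraction is exact because lam is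
   nonincreasing. *)
Definition muntz_exp (lam : seq nat) (j : nat) : nat :=
  (nth 0 lam 0 - nth 0 lam j + j)%N.

Definition muntz (n : nat) (lam : seq nat) : set (R -> R) :=
  fspan (fun (j : 'I_n.+1) t => t ^+ muntz_exp lam j).

(* f has a zero of multiplicity at least m at x. *)
Definition vanishes (m : nat) (f : R -> R) (x : R) : Prop :=
  forall i, (i < m)%N -> derive1n i f x = 0.

Record chebyshev_bernstein (n : nat) (lam : seq nat) (a b : R)
    (B : 'I_n.+1 -> R -> R) : Prop := ChebyshevBernstein {
  cb_span : fspan B = muntz n lam;
  cb_free : ffree B;
  cb_sum : forall t, 0 < t -> \sum_(k < n.+1) B k t = 1;
  cb_left : forall k : 'I_n.+1, vanishes k (B k) a;
  cb_right : forall k : 'I_n.+1, vanishes (n - k) (B k) b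
}.

End MuntzSpace.

(* Main.v *)
Require Import Defs.
From mathcomp Require Import all_boot all_order all_algebra.
From mathcomp Require Import all_classical all_reals all_analysis.
From mathcomp Require Import ring.
From mathcomp Require mpoly.
Import (canonicals) mpoly.
Import numFieldNormedType.Exports.
Import Order.TTheory GRing.Theory Num.Theory.
Local Open Scope ring_scope.

Set Implicit Arguments.
Unset Strict Implicit.
Unset Printing Implicit Defensive.

(** Each [B_k] agrees on the positive half-line with a polynomial [p_k], a
    combination of the monomials [X^(e_j)], [e_j = lambda_1 - lambda_(j+1) + j]
    (0 <= j <= n, [lambda_(n+1) = 0]).
    Put [G = p_k + ... + p_n].  It vanishes k times at a, and [1 - G] vanishes
    n+1-k times at b, so the coefficients of G solve the square linear system
    whose matrix M consists of the derivatives of orders 0, ..., k-1 at a and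
    0, ..., n-k at b of the monomials; moreover [G^(k)(a) = B_k^(k)(a)].
    Cramer's rule ([hermite_cramer]) gives [G^(k)(a) = det M' / det M], where M'
    has the k-th derivative at a in place of the value at b.  As [X^(e_0) = 1],
    expanding M' along its first column leaves a determinant of the same kind
    for the n derivatives [e_j X^(e_j - 1)] and the multiplicities k, n-k.

    A confluent determinant factors ([det_hermite]) as its value for the
    exponents 0, ..., m-1, which [det_hermite_idS] computes recursively, times
    the determinant [rem_det P e] of the coefficients of the remainders of the
    [X^(e_j)] modulo [P = (X-a)^p (X-b)^q].  The latter is a Schur polynomial in
    the roots of P, and no limit is involved when roots coincide.  The exponents
    [e_j] are complementary to the exponents [lambda_(j+1) + n - j] that define
    [S_lambda], so by [schur_complement] this remainder determinant is
    [S_lambda] at variables proportional to the inverses of the roots; inverting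
    a and b up to the factor ab exchanges them, which is why [S_lambda] appears
    at [(a^(n+1-k), b^k)] although G vanishes k times at a.  The exponents
    [e_j - 1] correspond to [lambda^(0)] in the same way.

    The factor [f_lambda(n+1) / f_(lambda^(0))(n) = e_1 ... e_n / n!] is the same
    expansion with both nodes equal to 1 and G = 1 ([rem_det_all_at_one_point]).
    The formula at b is the one at a for the family with a and b exchanged
    and the indices reversed ([bernstein_family_sym]).

    Division by det M is legitimate because of the basis itself: at a
    single point a nonzero combination of m monomials cannot vanish m times
    ([sparse_eq0]), hence [p_k] vanishes exactly k times at a, and then
    triangular elimination from both ends shows that M is invertible
    ([bf_unisolvent]). *)

(** * Determinants of powers and of remainders *)

Definition power_mx (A : comNzRingType) (m : nat) (u : 'I_m -> A)
  (e : 'I_m -> nat) : 'M[A]_m := \matrix_(i, j) u i ^+ e j.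

Definition root_poly (A : comNzRingType) (m : nat) (u : 'I_m -> A) : {poly A} :=
  \prod_(i < m) ('X - (u i)%:P).

Definition rem_mx (A : comNzRingType) (m : nat) (P : {poly A})
  (e : 'I_m -> nat) : 'M[A]_m :=
  \matrix_(l, j) (Pdiv.Ring.rmodp 'X^(e j) P)`_l.

(** For [P = root_poly u] this is the quotient of [\det (u_i ^ e_j)] by the
    Vandermonde determinant ([det_power_mx]); depending on u through P only, it
    makes sense for coinciding [u_i] and is symmetric in them. *)
Definition rem_det (A : comNzRingType) (m : nat) (P : {poly A})
  (e : 'I_m -> nat) : A := \det (rem_mx P e).

Section Remainders.
Variable A : comNzRingType.

Lemma root_poly_monic m (u : 'I_m -> A) : root_poly u \is monic.
Proof. by apply: monic_prod => i _; exact: monicXsubC. Qed.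

Lemma size_root_poly m (u : 'I_m -> A) : size (root_poly u) = m.+1.
Proof.
by rewrite /root_poly size_prod_XsubC -[index_enum _]enumT size_enum_ord.
Qed.

Lemma Xn_rem m (P : {poly A}) (e : 'I_m -> nat) (j : 'I_m) :
  P \is monic -> size P = m.+1 ->
  exists g, 'X^(e j) = \sum_(l < m) rem_mx P e l j *: 'X^l + P * g.
Proof.
move=> Pmon szP; exists (Pdiv.Ring.rdivp 'X^(e j) P).
rewrite {1}(Pdiv.RingMonic.rdivp_eq Pmon 'X^(e j)) addrC mulrC; congr (_ + _).
set r := Pdiv.Ring.rmodp _ _.
have szr : (size r <= m)%N.
  by rewrite -ltnS -szP Pdiv.Ring.ltn_rmodpN0 // monic_neq0.
transitivity (\poly_(l < m) r`_l).
  apply/polyP=> l; rewrite coef_poly; case: ltnP => // ml.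
  by rewrite nth_default // (leq_trans szr).
by rewrite poly_def; apply: eq_bigr => l _; rewrite mxE.
Qed.

(** Functionals that kill the multiples of P factor through the remainders. The
    evaluations at the roots of P give [det_power_mx], the Hermite data give
    [det_hermite]. *)
Lemma det_functionals m (P : {poly A}) (e : 'I_m -> nat)
    (F : 'I_m -> {poly A} -> A) :
  P \is monic -> size P = m.+1 ->
  (forall i c f g, F i (c *: f + g) = c * F i f + F i g) ->
  (forall i g, F i (P * g) = 0) ->
  \det (\matrix_(i, j) F i 'X^(e j)) =
    \det (\matrix_(i, j < m) F i 'X^j) * rem_det P e.
Proof.
move=> Pmon szP linF FP; rewrite -det_mulmx; congr (\det _).
apply/matrixP=> i j; rewrite !mxE.
have FD f g : F i (f + g) = F i f + F i g.
  by have := linF i 1 f g; rewrite scale1r mul1r.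
have F0 : F i 0 = 0 by have := FP i 0; rewrite mulr0.
have FZ c f : F i (c *: f) = c * F i f.
  by have := linF i c f 0; rewrite F0 !addr0.
have [g ->] := Xn_rem e j Pmon szP.
rewrite FD FP addr0 (big_morph (F i) FD F0).
by apply: eq_bigr => l _; rewrite FZ [in RHS]mulrC; congr (_ * _); rewrite mxE.
Qed.

Lemma det_power_mx m (u : 'I_m -> A) (e : 'I_m -> nat) :
  \det (power_mx u e) =
    \det (power_mx u (fun j => j)) * rem_det (root_poly u) e.
Proof.
have -> : power_mx u e = \matrix_(i, j) ('X^(e j)).[u i].
  by apply/matrixP=> i j; rewrite !mxE hornerXn.
have -> : power_mx u (fun j => j) = \matrix_(i, j < m) ('X^j).[u i].
  by apply/matrixP=> i j; rewrite !mxE hornerXn.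
apply: (@det_functionals _ _ _ (fun i p => p.[u i])).
- exact: root_poly_monic.
- exact: size_root_poly.
- by move=> i c p q; rewrite hornerD hornerZ.
- move=> i g; rewrite hornerM horner_prod (bigD1 i) //= hornerXsubC subrr.
  by rewrite !mul0r.
Qed.

(** Multiplying row i by [u_i ^ M] turns [v_i ^ N_j] into [c ^ N_j * u_i ^ e_j]:
    inverting the variables complements the exponents. *)
Lemma det_power_mx_inv m (u v : 'I_m -> A) (c : A) (M : nat)
    (N e : 'I_m -> nat) :
  (forall i, u i * v i = c) -> (forall j, N j + e j = M)%N ->
  (\prod_i u i) ^+ M * \det (power_mx v N) =
    c ^+ (\sum_j N j) * \det (power_mx u e).
Proof.
move=> uv Ne.
have -> : (\prod_i u i) ^+ M = \det (diag_mx (\row_i u i ^+ M)).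
  by rewrite det_diag -prodrXl; apply: eq_bigr => i _; rewrite mxE.
have -> : c ^+ (\sum_j N j) = \det (diag_mx (\row_(j < m) c ^+ N j)).
  by rewrite det_diag -prodrXr; apply: eq_bigr => i _; rewrite mxE.
rewrite [RHS]mulrC -!det_mulmx mul_diag_mx mul_mx_diag; congr (\det _).
apply/matrixP=> i j; rewrite !mxE -(Ne j) exprD mulrAC -exprMn uv.
by rewrite mulrC.
Qed.

End Remainders.

Lemma rem_det_map (A B : comNzRingType) (f : {rmorphism A -> B}) m
    (P : {poly A}) (e : 'I_m -> nat) :
  P \is monic -> f (rem_det P e) = rem_det (map_poly f P) e.
Proof.
move=> Pmon; rewrite /rem_det -det_map_mx; congr (\det _).
have fPmon := monic_map f Pmon.
apply/matrixP=> l j; rewrite !mxE -coef_map; congr (_`_l).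
rewrite -[in RHS](map_polyXn f) {2}(Pdiv.RingMonic.rdivp_eq Pmon 'X^(e j)).
rewrite rmorphD rmorphM /= Pdiv.RingMonic.rmodp_addl_mul_small //.
apply: (leq_ltn_trans (size_poly _ _)).
rewrite size_map_poly_id0 ?(monicP Pmon) ?rmorph1 ?oner_neq0 //.
by rewrite Pdiv.Ring.ltn_rmodpN0 ?monic_neq0.
Qed.

(** * Schur polynomials of reciprocal variables *)

Lemma alternantE (A : comNzRingType) m (u : 'I_m -> A) mu :
  alternant u mu = \det (power_mx u (fun j => nth 0 mu j + (m - j.+1)))%N.
Proof. by []. Qed.

Lemma alternant_map (A B : comNzRingType) (f : {rmorphism A -> B}) m
    (u : 'I_m -> A) mu : f (alternant u mu) = alternant (f \o u) mu.
Proof.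
rewrite -det_map_mx; congr (\det _).
by apply/matrixP=> i j; rewrite !mxE rmorphXn.
Qed.

Lemma alternant_eq (A : comNzRingType) m (u v : 'I_m -> A) mu :
  u =1 v -> alternant u mu = alternant v mu.
Proof.
by move=> uv; congr (\det _); apply/matrixP=> i j; rewrite !mxE uv.
Qed.

Lemma rev_ord_addn m (j : 'I_m) : (m - j.+1 + j = m.-1)%N.
Proof. by case: m j => [|m] j; [case: j | rewrite subSS subnK // -ltnS]. Qed.

(** The cancellation ending [schur_complement], stated for an abstract domain so
    that no large polynomial expression has to be normalized. *)
Lemma cancel_alternant (D : idomainType) (a b s s0 V r p a0 a1 : D) :
  s0 != 0 -> V != 0 -> p * a0 = a1 -> b * a0 = s0 * V ->
  a * b * a1 = s * s0 * (V * r) -> a * p = s * r.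
Proof.
move=> s00 V0 <- ba E; apply: (mulIf (mulf_neq0 s00 V0)).
transitivity (a * b * (p * a0)); first by rewrite -ba; ring.
by rewrite E; ring.
Qed.

(** Both sides are polynomial in u once w is written as
    [w_i = (c / \prod_l u_l) * \prod_(l != i) u_l].  For indeterminates u the
    identity follows from [det_power_mx_inv] applied to the numerator and the
    denominator of the Schur polynomial, the Vandermonde factor being cancelled
    in the polynomial ring; evaluation then covers coinciding [u_i]. *)
Lemma schur_complement (F : fieldType) m (mu : seq nat) (d : nat)
    (e : 'I_m -> nat) (u w : 'I_m -> F) (c : F) :
  c != 0 -> (forall i, u i * w i = c) ->
  (forall j : 'I_m, nth 0 mu j + e j = d + j)%N ->
  (\prod_i u i) ^+ d * mpoly.meval w (schur F m mu) =
    c ^+ (\sum_(j < m) nth 0 mu j)%N * rem_det (root_poly u) e.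
Proof.
move=> c0 uw mu_e.
have produ0 : \prod_i u i != 0.
  by apply/prodf_neq0 => i _; apply: contra_neq c0 => ui; rewrite -(uw i) ui mul0r.
pose ev : {rmorphism mpoly.mpoly m F -> F} := mpoly.meval u.
pose x := @mvar F m.
have xE i : ev (x i) = u i by rewrite /ev /= mpoly.mevalXU.
pose U := \prod_i x i.
have UE : ev U = \prod_i u i.
  by rewrite rmorph_prod; apply: eq_bigr => i _; rewrite xE.
(* In the ring of polynomials in the indeterminates x, v stands for w, K for
   c, and phi substitutes v for x. *)
pose q : mpoly.mpoly m F := mpoly.mpolyC m (c / \prod_i u i).
pose v i := q * \prod_(l | l != i) x l.
pose K := q * U.
have xv i : x i * v i = K by rewrite mulrCA /K /U [in RHS](bigD1 i).
have KE : ev K = c by rewrite rmorphM UE /ev /= mpoly.mevalC divfK.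
have K0 : K != 0 by apply: contra_neq c0 => K0; rewrite -KE K0 rmorph0.
have vE i : ev (v i) = w i.
  have ui0 : u i != 0 by apply: contra_neq c0 => ui; rewrite -(uw i) ui mul0r.
  by apply: (mulfI ui0); rewrite uw -KE -(xv i) [RHS]rmorphM xE.
pose phi : {rmorphism mpoly.mpoly m F -> mpoly.mpoly m F} :=
  mpoly.comp_mpoly (mktuple v).
have phix i : phi (x i) = v i.
  by rewrite /phi /= mpoly.comp_mpolyXU -tnth_nth tnth_mktuple.
pose S := schur F m mu.
have phiS : ev (phi S) = mpoly.meval w S.
  rewrite /ev /phi /= mpoly.comp_mpoly_meval; apply: mpoly.meval_eq => i.
  rewrite tnth_mktuple; exact: vE.
have altv nu : alternant v nu = phi (alternant x nu).
  by rewrite alternant_map; apply: alternant_eq => i; rewrite -phix.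
have SE : phi S * alternant v [::] = alternant v mu.
  by rewrite !altv -rmorphM /= schurE.
pose V := \det (power_mx x (fun j => j)).
have V0 : V != 0.
  apply: contraNneq (alternant_mvar_neq0 F m) => V0.
  by rewrite alternantE (det_power_mx x) -/V V0 mul0r.
pose N (nu : seq nat) (j : 'I_m) := (nth 0 nu j + (m - j.+1))%N.
have inv0 : U ^+ m.-1 * alternant v [::] = K ^+ (\sum_j N [::] j)%N * V.
  apply: (@det_power_mx_inv _ _ x v K m.-1 (N [::]) (fun j => j) xv) => j.
  by rewrite /N nth_nil rev_ord_addn.
have inv : U ^+ (d + m.-1) * alternant v mu =
    K ^+ (\sum_j N mu j)%N * (V * rem_det (root_poly x) e).
  rewrite -(det_power_mx x).
  apply: (@det_power_mx_inv _ _ x v K (d + m.-1) (N mu) e xv) => j.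
  by rewrite /N addnAC mu_e -addnA [(j + _)%N]addnC rev_ord_addn.
have sumN : (\sum_j N mu j = \sum_(j < m) nth 0 mu j + \sum_j N [::] j)%N.
  by rewrite -big_split; apply: eq_bigr => j _; rewrite /N nth_nil.
rewrite sumN !exprD in inv.
have key := cancel_alternant (expf_neq0 _ K0) V0 SE inv0 inv.
have := congr1 ev key.
rewrite !(rmorphM ev) !(rmorphXn ev) UE KE phiS.
rewrite (rem_det_map ev e (root_poly_monic x)) => ->.
congr (_ * rem_det _ _).
rewrite /root_poly rmorph_prod; apply: eq_bigr => i _.
by rewrite rmorphB /= map_polyX map_polyC /= xE.
Qed.

Lemma schur_atE (F : idomainType) m mu (us : seq F) : size us = m ->
  schur_at mu us = mpoly.meval (fun i => nth 0 us i) (schur F m mu).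
Proof. by move=> <-. Qed.

Lemma prod_nth_seq (A : comNzRingType) (B : Type) (f : B -> A) z (s : seq B) m :
  size s = m -> \prod_(i < m) f (nth z s i) = \prod_(x <- s) f x.
Proof. by move=> <-; rewrite (big_nth z) big_mkord. Qed.

Lemma prod_cat_nseq (A : comNzRingType) (B : Type) (f : B -> A) x y z p q m :
  (p + q = m)%N ->
  \prod_(i < m) f (nth z (nseq p x ++ nseq q y) i) = f x ^+ p * f y ^+ q.
Proof.
move=> pq; rewrite prod_nth_seq ?size_cat ?size_nseq //.
by rewrite big_cat /= !big_nseq !iter_mulr_1.
Qed.

Lemma root_poly_cat_nseq (F : fieldType) (x y : F) p q m : (p + q = m)%N ->
  root_poly (fun i : 'I_m => nth 0 (nseq p x ++ nseq q y) i) =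
  ('X - x%:P) ^+ p * ('X - y%:P) ^+ q.
Proof. exact: (prod_cat_nseq (fun t => 'X - t%:P)). Qed.

(** The choice [u = (y^p, x^q)], [w = (x^p, y^q)], [u_i w_i = xy] expresses a Schur
    polynomial at [(x^p, y^q)] by roots with the two multiplicities exchanged. *)
Lemma schur2_rem_det (F : fieldType) m p q (mu : seq nat) (d : nat)
    (e : 'I_m -> nat) (x y : F) :
  x != 0 -> y != 0 -> (p + q = m)%N ->
  (forall j : 'I_m, nth 0 mu j + e j = d + j)%N ->
  (y ^+ p * x ^+ q) ^+ d * schur2 mu x p y q =
    (x * y) ^+ (\sum_(j < m) nth 0 mu j)%N *
    rem_det (('X - y%:P) ^+ p * ('X - x%:P) ^+ q) e.
Proof.
move=> x0 y0 pq mue.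
rewrite -(root_poly_cat_nseq y x pq) -(prod_cat_nseq id y x 0 pq).
have sz : size (nseq p x ++ nseq q y) = m by rewrite size_cat !size_nseq.
rewrite /schur2 (schur_atE _ sz).
apply: (@schur_complement F m mu d e
  (fun i => nth 0 (nseq p y ++ nseq q x) i) (fun i => nth 0 (nseq p x ++ nseq q y) i)
  (x * y)) => //; first by rewrite mulf_neq0.
move=> i; rewrite !nth_cat !size_nseq !nth_nseq; case: ltnP => ip.
  by rewrite mulrC.
by rewrite ltn_subLR ?pq // ltn_ord.
Qed.

(** * Confluent Vandermonde determinants *)

Section Hermite.
Variable F : fieldType.
Implicit Types (a b : F) (g h : {poly F}).

Lemma derivn_XsubC_mul a h i :
  derivn i.+1 (('X - a%:P) * h) =
  ('X - a%:P) * derivn i.+1 h + derivn i h *+ i.+1.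
Proof.
elim: i => [|i IH].
  by rewrite derivn1 derivM derivXsubC mul1r addrC derivn1 mulr1n.
rewrite derivnS IH derivD derivM derivXsubC mul1r derivMn -!derivnS.
by rewrite [_ *+ i.+2]mulrS addrA [_ + derivn i.+1 h]addrC.
Qed.

(** By Leibniz' rule only the term where [(X-a)^m] is differentiated m times
    survives at a. *)
Lemma horner_derivn_exp_XsubC a m g i :
  (derivn i (('X - a%:P) ^+ m * g)).[a] =
  (i ^_ m)%:R * (derivn (i - m) g).[a].
Proof.
elim: m i => [|m IH] i; first by rewrite mul1r ffactn0 mul1r subn0.
rewrite exprS -mulrA; case: i => [|i].
  by rewrite derivn0 hornerM hornerXsubC subrr ffact0n !mul0r.
rewrite derivn_XsubC_mul hornerD hornerM hornerXsubC subrr mul0r add0r.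
by rewrite hornerMn IH ffactnS natrM subSS -mulr_natl mulrA.
Qed.

Definition hermite_fun a k b i (p : {poly F}) : F :=
  if (i < k)%N then (derivn i p).[a] else (derivn (i - k) p).[b].

Definition hermite_mx a k b m (e : 'I_m -> nat) : 'M[F]_m :=
  \matrix_(i, j) hermite_fun a k b i 'X^(e j).

Lemma hermite_fun_linear a k b i (c : F) (p h : {poly F}) :
  hermite_fun a k b i (c *: p + h) =
  c * hermite_fun a k b i p + hermite_fun a k b i h.
Proof.
by rewrite /hermite_fun; case: ifP => _; rewrite linearP hornerD hornerZ.
Qed.

Lemma hermite_fun_sum a k b i m (x : 'I_m -> F) (p : 'I_m -> {poly F}) :
  hermite_fun a k b i (\sum_j x j *: p j) =
  \sum_j hermite_fun a k b i (p j) * x j.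
Proof.
rewrite /hermite_fun; case: ifP => _; rewrite linear_sum horner_sum;
  by apply: eq_bigr => j _; rewrite linearZ hornerZ mulrC.
Qed.

Lemma hermite_fun_dvd a k b i m g : (i < m)%N ->
  hermite_fun a k b i (('X - a%:P) ^+ k * ('X - b%:P) ^+ (m - k) * g) = 0.
Proof.
rewrite /hermite_fun => im; case: ltnP => ik.
  by rewrite -mulrA horner_derivn_exp_XsubC ffact_small // mul0r.
rewrite [('X - _) ^+ _ * _]mulrC -mulrA horner_derivn_exp_XsubC ffact_small ?mul0r //.
exact: ltn_sub2r (leq_ltn_trans ik im) im.
Qed.

Lemma monic_exp2_XsubC a b p q :
  ('X - a%:P) ^+ p * ('X - b%:P) ^+ q \is monic.
Proof. by rewrite rpredM ?rpredX ?monicXsubC. Qed.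

Lemma size_exp2_XsubC a b p q :
  size (('X - a%:P) ^+ p * ('X - b%:P) ^+ q : {poly F}) = (p + q).+1.
Proof.
rewrite size_monicM ?monic_neq0 ?monic_exp ?monicXsubC //.
by rewrite !size_exp_XsubC addnS.
Qed.

Lemma det_hermite a k b m (e : 'I_m -> nat) : (k <= m)%N ->
  \det (hermite_mx a k b e) =
    \det (hermite_mx a k b (fun j : 'I_m => j)) *
    rem_det (('X - a%:P) ^+ k * ('X - b%:P) ^+ (m - k)) e.
Proof.
move=> km; apply: (@det_functionals _ _ _ _ (fun i => hermite_fun a k b i)).
- exact: monic_exp2_XsubC.
- by rewrite size_exp2_XsubC subnKC.
- by move=> i; exact: hermite_fun_linear.
- by move=> i g; rewrite hermite_fun_dvd.
Qed.

(** Replacing the last column [X^m] by the monic polynomial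
    [(X-a)^k (X-b)^(m-k)] does not change the determinant, and all functionals
    but the last one vanish on that polynomial. *)
Lemma det_hermite_idS a k b m : (k <= m)%N ->
  \det (hermite_mx a k b (fun j : 'I_m.+1 => j)) =
    (m - k)`!%:R * (b - a) ^+ k * \det (hermite_mx a k b (fun j : 'I_m => j)).
Proof.
move=> km; set P := ('X - a%:P) ^+ k * ('X - b%:P) ^+ (m - k).
have szP : size P = m.+1 by rewrite size_exp2_XsubC subnKC.
(* T is the unitriangular change of basis from the monomials to N. *)
pose N (j : 'I_m.+1) := if (j < m)%N then 'X^j else P.
have NE (j : 'I_m.+1) : N j = \sum_(l < m.+1) (N j)`_l *: 'X^l.
  rewrite -poly_def; apply/polyP=> l; rewrite coef_poly; case: ltnP => // ml.
  rewrite nth_default // (leq_trans _ ml) // /N.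
  by case: ifP; rewrite ?size_polyXn ?szP.
pose T : 'M[F]_m.+1 := \matrix_(l, j) (N j)`_l.
have detT : \det T = 1.
  rewrite -det_tr det_trig.
    rewrite big1 // => i _; rewrite !mxE /N; case: ltnP => [_|mi].
      by rewrite coefXn eqxx.
    have -> : i = m :> nat by apply/eqP; rewrite eqn_leq mi -ltnS ltn_ord.
    have /monicP := monic_exp2_XsubC a b k (m - k).
    by rewrite lead_coefE -/P szP.
  apply/is_trig_mxP=> i j ij; rewrite !mxE /N ifT.
    by rewrite coefXn gtn_eqF.
  by rewrite (leq_trans ij) // -ltnS.
set H := hermite_mx _ _ _ _; rewrite -[LHS]mulr1 -[X in _ * X = _]detT -det_mulmx.
have HT : H *m T = \matrix_(i, j) hermite_fun a k b i (N j).
  apply/matrixP=> i j; rewrite mxE [RHS]mxE NE hermite_fun_sum.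
  by apply: eq_bigr => l _; rewrite !mxE.
rewrite HT (expand_det_col _ ord_max) (bigD1 ord_max) //= big1 ?addr0.
  congr (_ * _).
    rewrite mxE /N /= ltnn /hermite_fun ltnNge km /= /P [_ ^+ k * _]mulrC.
    by rewrite horner_derivn_exp_XsubC ffactnn subnn derivn0 horner_exp hornerXsubC.
  rewrite /cofactor /= addnn -signr_odd odd_double expr0 mul1r; congr (\det _).
  by apply/matrixP=> i j; rewrite !mxE /N !lift_max ltn_ord.
move=> i im; rewrite mxE /N ltnn -[P]mulr1 hermite_fun_dvd ?mul0r //.
by rewrite ltn_neqAle -ltnS ltn_ord andbT.
Qed.

(** Cramer's rule, in a form without division: the cofactors of row k are
    common to A and B, and x is proportional to those of A. *)
Lemma det_replace_row n (A B : 'M[F]_n) (k : 'I_n) (x : 'cV[F]_n) :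
  (forall i j, i != k -> A i j = B i j) -> A *m x = delta_mx k 0 ->
  \det B = (B *m x) k 0 * \det A.
Proof.
move=> AB Ax; rewrite (expand_det_row _ k) mxE mulr_suml.
apply: eq_bigr => j _; rewrite -mulrA; congr (_ * _).
have : \det A *: x = \adj A *m delta_mx k 0.
  by rewrite -Ax mulmxA mul_adj_mx mul_scalar_mx.
move=> /matrixP/(_ j 0); rewrite !mxE (bigD1 k) //= !mxE !eqxx mulr1 big1 ?addr0.
  rewrite mulrC => ->; rewrite /cofactor; congr (_ * \det _).
  by apply/matrixP=> i l; rewrite !mxE AB // eq_sym neq_lift.
by move=> i ik; rewrite !mxE (negPf ik) mulr0.
Qed.

(** The derivative of order k of G at a, through the ratio of two confluent
    determinants. The factor [\prod_j e_(j+1)] and the exponents [e_(j+1) - 1]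
    come from differentiating the monomials other than [X^(e_0) = 1]. *)
Lemma hermite_cramer a k b m (e : 'I_m.+1 -> nat) (x : 'I_m.+1 -> F) :
  let G := \sum_j x j *: 'X^(e j) in
  (k <= m)%N -> e ord0 = 0%N ->
  (forall i, (i < k)%N -> (derivn i G).[a] = 0) ->
  (forall i, (i <= m - k)%N -> (derivn i G).[b] = (i == 0%N)%:R) ->
  (derivn k G).[a] * \det (hermite_mx a k b e) =
    (\prod_(j < m) e (lift ord0 j))%:R *
    \det (hermite_mx a k b (fun j : 'I_m => (e (lift ord0 j)).-1)).
Proof.
move=> G km e0 Ga Gb; pose k' : 'I_m.+1 := Ordinal (n := m.+1) (m := k) km.
pose A := hermite_mx a k b e.
(* B has the derivative of order k at a where A has the value at b. *)
pose B : 'M[F]_m.+1 := \matrix_(i, j) 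
  (if (i <= k)%N then (derivn i 'X^(e j)).[a] else (derivn (i - k) 'X^(e j)).[b]).
have AB i j : i != k' -> A i j = B i j.
  by move=> ik; rewrite !mxE /hermite_fun ltn_neqAle -[k]/(val k') val_eqE ik.
pose c : 'cV[F]_m.+1 := \col_j x j.
have Ac : A *m c = delta_mx k' 0.
  apply/matrixP=> i j; rewrite !mxE ord1 eqxx andbT.
  under eq_bigr do rewrite !mxE.
  rewrite -hermite_fun_sum -/G /hermite_fun -val_eqE /=; case: ltnP => ik.
    by rewrite Ga // ltn_eqF.
  by rewrite Gb ?leq_sub2r -1?ltnS // subn_eq0 eqn_leq ik andbT.
have Bc : (B *m c) k' 0 = (derivn k G).[a].
  rewrite mxE linear_sum horner_sum; apply: eq_bigr => j _.
  by rewrite !mxE /= leqnn linearZ hornerZ mulrC.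
(* Every row of B but the first is a derivative of positive order, which
   kills the constant first monomial. *)
rewrite -Bc -(det_replace_row AB Ac) (expand_det_col _ ord0) big_ord_recl.
rewrite big1 ?addr0; last first.
  move=> i _; rewrite !mxE e0 expr0 -polyC1; case: ifP => ik; rewrite derivnC.
    by rewrite /= horner0 mul0r.
  by rewrite subn_eq0 ik horner0 mul0r.
rewrite mxE e0 expr0 /= hornerC mul1r /cofactor expr0 mul1r.
rewrite natr_prod.
have -> : \prod_(j < m) (e (lift ord0 j))%:R =
    \det (diag_mx (\row_(j < m) (e (lift ord0 j))%:R)) :> F.
  by rewrite det_diag; apply: eq_bigr => j _; rewrite mxE.
rewrite mulrC -det_mulmx mul_mx_diag; congr (\det _).
apply/matrixP=> i j; rewrite !mxE /hermite_fun lift0.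
have dX n : derivn n.+1 ('X^(e (lift ord0 j)) : {poly F}) =
    (e (lift ord0 j))%:R *: derivn n 'X^((e (lift ord0 j)).-1).
  by rewrite /derivn iterSr derivXn -/(derivn n _) derivnMn scaler_nat.
case: ltnP => ik; first by rewrite dX hornerZ mulrC.
by rewrite subSn // dX hornerZ mulrC.
Qed.

End Hermite.

(** * Zeros of sparse polynomials *)

Section Sparse.
Variable F : numFieldType.
Implicit Types a b : F.

Lemma derivn_eq0_dvdp a m (p : {poly F}) :
  (forall i, (i < m)%N -> (derivn i p).[a] = 0) -> ('X - a%:P) ^+ m %| p.
Proof.
elim: m => [|m IH] pa; first by rewrite expr0 dvd1p.
have /dvdpP[g pE] : ('X - a%:P) ^+ m %| p by apply: IH => i im; exact/pa/ltnW.
have /eqP := pa m (ltnSn m).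
rewrite pE mulrC horner_derivn_exp_XsubC ffactnn subnn mulf_eq0 pnatr_eq0.
rewrite -leqn0 leqNgt fact_gt0 /= => ga.
by rewrite exprSr dvdp_mul2l ?expf_neq0 ?polyXsubC_eq0 // dvdp_XsubCl.
Qed.

Lemma dvdp_deriv_exp_XsubC a m (p : {poly F}) :
  ('X - a%:P) ^+ m.+1 %| p -> ('X - a%:P) ^+ m %| deriv p.
Proof.
move=> /dvdpP[q ->]; rewrite derivM deriv_exp derivXsubC mul1r.
rewrite dvdp_add //; first by rewrite exprS !dvdp_mull.
by rewrite -mulr_natl mulrA dvdp_mull.
Qed.

(** A combination of m monomials cannot vanish m times at a nonzero point: divide
    by the lowest monomial and differentiate, which loses one monomial and one
    order of vanishing. *)
Lemma sparse_eq0 a m (e : 'I_m -> nat) (x : 'I_m -> F) :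
  a != 0 -> (forall i j : 'I_m, (i < j)%N -> (e i < e j)%N) ->
  ('X - a%:P) ^+ m %| \sum_j x j *: 'X^(e j) -> forall j, x j = 0.
Proof.
move=> a0; elim: m e x => [|m IH] e x lte; first by move=> _ [].
pose e' (j : 'I_m) := (e (lift ord0 j) - e ord0)%N.
have e'_gt0 j : (0 < e' j)%N by rewrite subn_gt0 lte.
pose g := x ord0 *: 1 + \sum_j x (lift ord0 j) *: 'X^(e' j).
have -> : \sum_j x j *: 'X^(e j) = 'X^(e ord0) * g.
  rewrite big_ord_recl mulrDr -scalerAr mulr1 mulr_sumr; congr (_ + _).
  by apply: eq_bigr => j _; rewrite -scalerAr -exprD subnKC // ltnW // lte.
rewrite Gauss_dvdpr; last first.
  rewrite coprimep_expl // coprimep_sym coprimep_XsubC.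
  by rewrite rootE hornerXn expf_neq0.
move=> dvd_g.
have x_lift j : x (lift ord0 j) = 0.
  have /IH : forall i j : 'I_m, (i < j)%N -> ((e' i).-1 < (e' j).-1)%N.
    move=> k l kl; rewrite -ltnS !prednK //.
    by rewrite ltn_sub2r ?lte // lte.
  move=> /(_ (fun j => x (lift ord0 j) * (e' j)%:R)) H.
  have /eqP : x (lift ord0 j) * (e' j)%:R = 0.
    apply: H; have := dvdp_deriv_exp_XsubC dvd_g.
    congr (_ %| _); rewrite derivD linearZ /= derivC scaler0 add0r linear_sum.
    apply: eq_bigr => l _; rewrite linearZ /= derivXn -scalerA; congr (_ *: _).
    by rewrite scaler_nat.
  by rewrite mulf_eq0 pnatr_eq0 eqn0Ngt e'_gt0 orbF => /eqP.
move=> j; case: (unliftP ord0 j) => [l|] ->; first exact: x_lift.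
have : root g a.
  by rewrite root_factor_theorem (dvdp_trans _ dvd_g) // exprS dvdp_mulr.
rewrite rootE /g big1 ?addr0 => [|l _]; last by rewrite x_lift scale0r.
by rewrite hornerZ hornerC mulr1 => /eqP.
Qed.

Lemma det_hermite_point_neq0 a b m (e : 'I_m -> nat) :
  b != 0 -> (forall i j : 'I_m, (i < j)%N -> (e i < e j)%N) ->
  \det (hermite_mx a 0 b e) != 0.
Proof.
move=> b0 lte; rewrite -det_tr; apply/det0P => -[v v0 vH].
case/negP: v0; apply/eqP/rowP => j; rewrite [RHS]mxE.
apply: (@sparse_eq0 b m e (v 0)) => //; apply: derivn_eq0_dvdp => i im.
move/matrixP/(_ 0 (Ordinal im)): vH; rewrite !mxE => vH.
have := hermite_fun_sum a 0 b i (v 0) (fun j => 'X^(e j)).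
rewrite /hermite_fun /= subn0 => ->; rewrite -[RHS]vH.
by apply: eq_bigr => l _; rewrite !mxE /hermite_fun /= subn0 mulrC.
Qed.

End Sparse.

(** * Polynomial Bernstein families *)

(** The Chebyshev-Bernstein conditions on the polynomials representing the
    functions. Freeness and vanishing are kept as equations because in this form
    reversal of the indices exchanges a and b. *)
Record bernstein_family (F : numFieldType) n (e : 'I_n.+1 -> nat) (a b : F)
    (p : 'I_n.+1 -> {poly F}) : Prop := BernsteinFamily {
  bf_span : forall k, exists x : 'I_n.+1 -> F, p k = \sum_j x j *: 'X^(e j);
  bf_free : forall c : 'I_n.+1 -> F,
    \sum_k c k *: p k = 0 -> forall k, c k = 0;
  bf_sum : \sum_k p k = 1;
  bf_left : forall (k : 'I_n.+1) i, (i < k)%N -> (derivn i (p k)).[a] = 0;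
  bf_right : forall (k : 'I_n.+1) i, (i < n - k)%N -> (derivn i (p k)).[b] = 0
}.

Section Bernstein.
Variables (F : numFieldType) (n : nat) (e : 'I_n.+1 -> nat).
Implicit Types (a b : F) (p : 'I_n.+1 -> {poly F}).

Lemma bernstein_family_sym a b p :
  bernstein_family e a b p -> bernstein_family e b a (fun k => p (rev_ord k)).
Proof.
case=> sp fr su le ri; split.
- by move=> k; exact: sp.
- move=> c c0 k; rewrite -(rev_ordK k).
  apply: (fr (fun k => c (rev_ord k))); rewrite -[RHS]c0.
  rewrite (reindex_inj rev_ord_inj) /=.
  by apply: eq_bigr => l _; rewrite rev_ordK.
- by rewrite -[RHS]su [RHS](reindex_inj rev_ord_inj).
- move=> k i ik; apply: ri; rewrite /= subSS subKn //.
  by rewrite -ltnS.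
- by move=> k i ik; apply: le; rewrite /= subSS.
Qed.

Hypothesis lte : forall i j : 'I_n.+1, (i < j)%N -> (e i < e j)%N.

Lemma bf_coefs a b p : bernstein_family e a b p ->
  exists2 X : 'M[F]_n.+1, \det X != 0 &
    forall k, p k = \sum_j X k j *: 'X^(e j).
Proof.
move=> bf; have [x px] := choice (bf_span bf).
exists (\matrix_(k, j) x k j); last first.
  by move=> k; rewrite px; apply: eq_bigr => j _; rewrite mxE.
apply/det0P => -[v v0 vX]; case/negP: v0; apply/eqP/rowP => k.
rewrite [RHS]mxE; apply: (bf_free bf (c := v 0)).
transitivity (\sum_j (v *m \matrix_(k, j) x k j) 0 j *: 'X^(e j)).
  transitivity (\sum_k \sum_j (v 0 k * x k j) *: ('X^(e j) : {poly F})).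
    apply: eq_bigr => l _; rewrite px scaler_sumr.
    by apply: eq_bigr => j _; rewrite scalerA.
  rewrite exchange_big; apply: eq_bigr => j _ /=; rewrite mxE scaler_suml.
  by apply: eq_bigr => l _; rewrite mxE.
by rewrite vX big1 // => j _; rewrite mxE scale0r.
Qed.

(** The matrix of the derivatives [p_l^(i)(a)] is triangular; it is also the
    product of the invertible Wronskian matrix of the monomials at a and of the
    invertible coefficient matrix. *)
Lemma bf_diag_neq0 a b p (k : 'I_n.+1) : a != 0 ->
  bernstein_family e a b p -> (derivn k (p k)).[a] != 0.
Proof.
move=> a0 bf; have [X X0 pE] := bf_coefs bf.
have WX i l : (hermite_mx b 0 a e *m X^T) i l = (derivn i (p l)).[a].
  have := hermite_fun_sum b 0 a i (X l) (fun j => 'X^(e j)).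
  rewrite -pE /hermite_fun /= subn0 => ->; rewrite mxE.
  by apply: eq_bigr => j _; rewrite !mxE /hermite_fun /= subn0.
have : \det (hermite_mx b 0 a e *m X^T) != 0.
  by rewrite det_mulmx det_tr mulf_neq0 // det_hermite_point_neq0.
rewrite det_trig; first by move=> /prodf_neq0/(_ k isT); rewrite WX.
by apply/is_trig_mxP => i l il; rewrite WX (bf_left bf).
Qed.

(** Only [p_0, ..., p_i] contribute to the derivative of order i at a, and [p_i]
    does so with a nonzero value: the coefficients vanish one after the other. *)
Lemma bf_elim a b p (c : 'I_n.+1 -> F) (m : nat) : a != 0 ->
  bernstein_family e a b p ->
  (forall i, (i < m)%N -> (derivn i (\sum_k c k *: p k)).[a] = 0) ->
  forall k : 'I_n.+1, (k < m)%N -> c k = 0.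
Proof.
move=> a0 bf ca k; have [N kN] := ubnP (k : nat).
elim: N k kN => // N IH k kN km.
have /eqP := ca k km; rewrite linear_sum horner_sum (bigD1 k) //= big1 ?addr0.
  by rewrite linearZ hornerZ mulf_eq0 (negPf (bf_diag_neq0 k a0 bf)) orbF => /eqP.
move=> l lk; rewrite linearZ hornerZ /=.
have [kl|lk'] := ltnP k l; first by rewrite (bf_left bf) ?mulr0.
have lk2 : (l < k)%N by rewrite ltn_neqAle lk' andbT.
by rewrite IH ?mul0r // (leq_trans lk2) // ltnW.
Qed.

(** A combination of the [p_l] killed by the Hermite functionals has its first k
    coefficients zero by elimination at a, and the others by elimination at b. *)
Lemma bf_unisolvent a b p (k : 'I_n.+1) : a != 0 -> b != 0 ->
  bernstein_family e a b p -> \det (hermite_mx a k b e) != 0.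
Proof.
move=> a0 b0 bf; have [X X0 pE] := bf_coefs bf.
rewrite -det_tr; apply/det0P => -[v v0 vH].
have Xu : X \in unitmx by rewrite unitmxE unitfE.
pose c := v *m invmx X; pose f := \sum_j v 0 j *: ('X^(e j) : {poly F}).
have fE : f = \sum_l c 0 l *: p l.
  have vE : v = c *m X by rewrite mulmxKV.
  rewrite /f {1}vE; under eq_bigr do rewrite mxE scaler_suml.
  rewrite exchange_big; apply: eq_bigr => l _ /=; rewrite pE scaler_sumr.
  by apply: eq_bigr => j _; rewrite scalerA.
have f0 i : (i < n.+1)%N -> hermite_fun a k b i f = 0.
  move=> im; rewrite hermite_fun_sum.
  move/matrixP/(_ 0 (Ordinal im)): vH; rewrite !mxE => vH; rewrite -[RHS]vH.
  by apply: eq_bigr => l _; rewrite !mxE mulrC.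
suff c0 : c = 0 by case/negP: v0; rewrite -(mulmxKV Xu v) -/c c0 mul0mx.
apply/rowP => l; rewrite [RHS]mxE; have [lk|kl] := ltnP l k.
  apply: (bf_elim a0 bf (c := c 0) (m := k)) => // i ik; rewrite -fE.
  have := f0 i (ltn_trans ik (ltn_ord k)).
  by rewrite /hermite_fun ik.
rewrite -(rev_ordK l).
apply: (bf_elim b0 (bernstein_family_sym bf)
  (c := fun l => c 0 (rev_ord l)) (m := n.+1 - k)).
  move=> i ik; have ink : (i + k < n.+1)%N by rewrite addnC -ltn_subRL.
  have := f0 _ ink.
  rewrite /hermite_fun ltnNge leq_addl /= addnK fE.
  by rewrite (reindex_inj rev_ord_inj).
by rewrite /= ltn_sub2l // ltnS.
Qed.

(** [hermite_cramer] for the tail sum [G = \sum_(l >= k) p_l], with the confluent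
    Vandermonde determinants of sizes n+1 and n cancelled. *)
Lemma bf_derivative a b p (k : 'I_n.+1) : a != 0 -> b != 0 -> e ord0 = 0%N ->
  bernstein_family e a b p ->
  let rho := rem_det (('X - a%:P) ^+ k * ('X - b%:P) ^+ (n.+1 - k)) e in
  rho != 0 /\
  (derivn k (p k)).[a] * ((n - k)`!%:R * (b - a) ^+ k * rho) =
    (\prod_(j < n) e (lift ord0 j))%:R *
    rem_det (('X - a%:P) ^+ k * ('X - b%:P) ^+ (n - k))
      (fun j : 'I_n => (e (lift ord0 j)).-1).
Proof.
move=> a0 b0 e0 bf rho; have [X X0 pE] := bf_coefs bf.
have kn : (k <= n)%N by rewrite -ltnS.
pose x j := \sum_(l < n.+1 | (k <= l)%N) X l j.
pose G := \sum_j x j *: ('X^(e j) : {poly F}).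
have GE : G = \sum_(l < n.+1 | (k <= l)%N) p l.
  under eq_bigr do rewrite pE.
  by rewrite exchange_big; apply: eq_bigr => j _; rewrite scaler_suml.
have Ga i : (i < k)%N -> (derivn i G).[a] = 0.
  move=> ik; rewrite GE linear_sum horner_sum big1 // => l kl.
  by rewrite /= (bf_left bf) // (leq_trans ik).
have Gak : (derivn k G).[a] = (derivn k (p k)).[a].
  rewrite GE linear_sum horner_sum (bigD1 k) //= big1 ?addr0 // => l /andP[kl lk].
  by rewrite (bf_left bf) // ltn_neqAle eq_sym lk.
have Gb i : (i <= n - k)%N -> (derivn i G).[b] = (i == 0%N)%:R.
  move=> ik; have -> : G = 1 - \sum_(l < n.+1 | (l < k)%N) p l.
    rewrite GE -(bf_sum bf) [X in X - _](bigID (fun l : 'I_n.+1 => (k <= l)%N)) /=.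
    by under [X in _ = _ + X - _]eq_bigl do rewrite -ltnNge; rewrite addrK.
  rewrite linearB hornerD hornerN linear_sum horner_sum /= big1 ?subr0.
    by rewrite -polyC1 derivnC; case: eqP; rewrite ?horner0 ?hornerC.
  move=> l lk; rewrite (bf_right bf) // (leq_ltn_trans ik) //.
  by rewrite ltn_sub2l // (leq_trans lk).
have H := bf_unisolvent k a0 b0 bf.
have := hermite_cramer kn e0 Ga Gb; rewrite -/G Gak.
have H2 := H; rewrite det_hermite 1?ltnW // in H2.
rewrite det_hermite 1?ltnW // [in RHS]det_hermite //.
move: H2; rewrite det_hermite_idS // !mulf_eq0 !negb_or -!andbA => /and4P[_ _ V0 r0].
move=> E; split => //; apply: (mulIf V0).
rewrite -[RHS]mulrA [rem_det _ _ * _]mulrC -E -/rho; ring.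
Qed.

(** [hermite_cramer] for [G = 1] and a single node: with all variables equal to 1
    it evaluates the ratio [f_lambda(n+1) / f_(lambda^(0))(n)]. *)
Lemma rem_det_all_at_one_point b : b != 0 -> e ord0 = 0%N ->
  let rho' := rem_det (('X - b%:P) ^+ n)
    (fun j : 'I_n => (e (lift ord0 j)).-1) in
  rho' != 0 /\
  n`!%:R * rem_det (('X - b%:P) ^+ n.+1) e =
    (\prod_(j < n) e (lift ord0 j))%:R * rho'.
Proof.
move=> b0 e0 rho'.
have lte' (i j : 'I_n) : (i < j)%N ->
    ((e (lift ord0 i)).-1 < (e (lift ord0 j)).-1)%N.
  move=> ij; have egt0 l : (0 < e (lift ord0 l))%N by rewrite -e0 lte.
  by rewrite -ltnS !prednK // lte.
pose x (j : 'I_n.+1) : F := (j == ord0)%:R.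
(* The indicator x of the first index is the coefficient vector of G = 1. *)
have G1 : \sum_j x j *: ('X^(e j) : {poly F}) = 1.
  rewrite big_ord_recl /x eqxx e0 scale1r big1 ?addr0 // => i _.
  by rewrite -val_eqE /= scale0r.
have Gb i : (i <= n - 0)%N ->
    (derivn i (\sum_j x j *: ('X^(e j) : {poly F}))).[b] = (i == 0%N)%:R.
  by rewrite G1 -polyC1 derivnC; case: eqP; rewrite ?horner0 ?hornerC.
have := @hermite_cramer F b 0 b n e x (leq0n n) e0 (fun i => ltac:(by [])) Gb.
have := det_hermite_point_neq0 b b0 lte'.
rewrite G1 derivn0 hornerC mul1r (det_hermite b b e (leq0n n.+1)).
rewrite (det_hermite b b _ (leq0n n)) det_hermite_idS //.
rewrite !expr0 !mul1r !subn0 mulr1 mulf_eq0 negb_or => /andP[V0 r0] E.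
split => //; apply: (mulIf V0).
rewrite -[RHS]mulrA [rho' * _]mulrC -E; ring.
Qed.

End Bernstein.

(** * From Chebyshev-Bernstein bases to polynomials *)

Section PolynomialFunctions.
Variable R : realType.

Lemma derive1n_horner_gt0 (f : R -> R) (p : {poly R}) i :
  (forall t, 0 < t -> f t = p.[t]) ->
  forall t, 0 < t -> derive1n i f t = (derivn i p).[t].
Proof.
move=> fp; elim: i => [|i IH] t t0; first exact: fp.
rewrite derive1nS derivnS derivE !derive1E; apply: near_eq_derive.
near=> s; apply: IH; near: s; exact: lt_nbhsr.
Unshelve. all: by end_near. Qed.

Lemma poly_eq_gt0 (p q : {poly R}) :
  (forall t, 0 < t -> p.[t] = q.[t]) -> p = q.
Proof.
move=> pq; apply/eqP; rewrite -subr_eq0; apply/eqP.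
pose rs : seq R := [seq i.+1%:R | i <- iota 0 (size (p - q))].
apply: (@roots_geq_poly_eq0 _ _ rs).
- apply/allP => _ /mapP[i _ ->].
  by rewrite rootE hornerD hornerN pq ?ltr0n // subrr.
- rewrite map_inj_uniq ?iota_uniq // => i j /eqP.
  by rewrite eqr_nat => /eqP[].
- by rewrite size_map size_iota.
Qed.

End PolynomialFunctions.

Section MuntzExponents.
Variable lam : seq nat.
Hypothesis lam_sorted : sorted geq lam.

Lemma nth_nonincreasing i j : (i <= j)%N -> (nth 0 lam j <= nth 0 lam i)%N.
Proof.
move=> ij; have [js|] := ltnP j (size lam); last by move=> js; rewrite nth_default.
have geq_trans : transitive geq by move=> y x z xy yz; apply: leq_trans yz xy.
have := sorted_leq_nth geq_trans (fun x => leqnn x) 0%N lam_sorted.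
by apply => //; rewrite inE // (leq_ltn_trans ij).
Qed.

Lemma muntz_expK j : (nth 0 lam j + muntz_exp lam j = nth 0 lam 0 + j)%N.
Proof. by rewrite /muntz_exp addnA subnKC // nth_nonincreasing. Qed.

Lemma muntz_exp_lt i j : (i < j)%N -> (muntz_exp lam i < muntz_exp lam j)%N.
Proof.
move=> ij; rewrite /muntz_exp -addnS leq_add // leq_sub2l //.
exact/nth_nonincreasing/ltnW.
Qed.

Lemma muntz_exp_behead j :
  (nth 0 (behead lam) j + (muntz_exp lam j.+1).-1 = nth 0 lam 0 + j)%N.
Proof.
by rewrite nth_behead /muntz_exp addnS /= addnA subnKC // nth_nonincreasing.
Qed.

End MuntzExponents.

Lemma chebyshev_bernstein_poly (R : realType) n lam (a b : R) (B : 'I_n.+1 -> R -> R) :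
  0 < a -> 0 < b -> chebyshev_bernstein lam a b B ->
  exists2 p : 'I_n.+1 -> {poly R},
    bernstein_family (fun j : 'I_n.+1 => muntz_exp lam j) a b p &
    forall k t, 0 < t -> B k t = (p k).[t].
Proof.
move=> a0 b0 cb.
have [x Bx] : exists x : 'I_n.+1 -> 'I_n.+1 -> R, forall k t, 0 < t ->
    B k t = \sum_j x k j * t ^+ muntz_exp lam j.
  suff /choice[x Bx] : forall k, exists y : 'I_n.+1 -> R, forall t, 0 < t ->
      B k t = \sum_j y j * t ^+ muntz_exp lam j by exists x.
  move=> k.
  have : fspan B (B k).
    exists (fun j => (j == k)%:R) => t _; rewrite (bigD1 k) //= eqxx mul1r.
    by rewrite big1 ?addr0 // => l /negPf ->; rewrite mul0r.
  by rewrite (cb_span cb).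
pose p k := \sum_j x k j *: ('X^(muntz_exp lam j) : {poly R}).
have pB k t : 0 < t -> B k t = (p k).[t].
  move=> t0; rewrite Bx // horner_sum; apply: eq_bigr => j _.
  by rewrite hornerZ hornerXn.
exists p => //; split.
- by move=> k; exists (x k).
- move=> c c0; apply: (cb_free cb) => t t0; rewrite -[RHS](horner0 t) -c0.
  by rewrite horner_sum; apply: eq_bigr => k _; rewrite hornerZ pB.
- apply: poly_eq_gt0 => t t0; rewrite hornerC -(cb_sum cb t0) horner_sum.
  by apply: eq_bigr => k _; rewrite pB.
- move=> k i ik; rewrite -(derive1n_horner_gt0 i (pB k) a0).
  exact: (cb_left cb).
- move=> k i ik; rewrite -(derive1n_horner_gt0 i (pB k) b0).
  exact: (cb_right cb).
Qed.

(** * Evaluation of the extremal derivatives *)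

Lemma schur1_rem_det (F : fieldType) m (mu : seq nat) (d : nat)
    (e : 'I_m -> nat) :
  (forall j : 'I_m, nth 0 mu j + e j = d + j)%N ->
  schur1 F mu m = rem_det (('X - 1%:P) ^+ m) e.
Proof.
move=> mue; have := schur2_rem_det (oner_neq0 F) (oner_neq0 F) (addn0 m) mue.
rewrite !expr1n !mul1r expr0 mulr1 /schur2 cats0 !expr1n !mul1r => <-.
by [].
Qed.

(** Two instances of [schur2_rem_det] with the same [xy = z z'] divided by one
    another: passing from S0 to S adds the root z, of product u before, and
    raises the degree by d, so that all powers cancel but that of z'. *)
Lemma schur_ratio_of_complements (F : fieldType) d s (u z z' S S0 r r0 : F) :
  u != 0 -> z != 0 -> z' != 0 -> r != 0 ->
  (u * z) ^+ d * S = (z * z') ^+ (d + s) * r ->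
  u ^+ d * S0 = (z * z') ^+ s * r0 ->
  z' ^+ d * (S0 / S) = r0 / r.
Proof.
move=> u0 z0 z'0 r_0 ES ES0.
have ud0 : u ^+ d != 0 by rewrite expf_neq0.
have zd0 : z ^+ d != 0 by rewrite expf_neq0.
have z'd0 : z' ^+ d != 0 by rewrite expf_neq0.
have zs0 : (z * z') ^+ s != 0 by rewrite expf_neq0 ?mulf_neq0.
move: ES ES0; rewrite exprD !(exprMn d).
move: (u ^+ d) (z ^+ d) (z' ^+ d) ((z * z') ^+ s) ud0 zd0 z'd0 zs0.
move=> U Z Z' W U0 Z0 Z'0 W0 ES ES0.
have -> : S = Z' * W * r / U.
  apply: (mulfI (mulf_neq0 U0 Z0)); rewrite ES; field.
  exact: U0.
have -> : S0 = W * r0 / U by apply: (mulfI U0); rewrite ES0; field.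
by field; rewrite U0 Z'0 W0 r_0.
Qed.

Lemma leading_derivative_solve (F : fieldType) (y w rho E rho' nf S1 S1' ad q : F) :
  w != 0 -> rho != 0 -> S1' != 0 ->
  y * (w * rho) = E * rho' -> nf * S1 = E * S1' -> ad * q = rho' / rho ->
  y = nf * ad / w * (S1 / S1') * q.
Proof.
move=> w0 r0 S0 Ey En Eq.
have -> : nf * ad / w * (S1 / S1') * q = (nf * S1) * (ad * q) / (w * S1').
  by field; rewrite w0 S0.
rewrite En Eq; apply: (mulIf (mulf_neq0 w0 r0)); rewrite Ey; field.
by rewrite w0 r0 S0.
Qed.

Theorem theorem6 (R : realType) (n : nat) (lam : seq nat) (a b : R)
    (B : 'I_n.+1 -> R -> R) :
  (1 <= n)%N ->
  sorted geq lam -> (size lam <= n)%N ->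
  0 < a -> a < b ->
  chebyshev_bernstein lam a b B ->
  let lam0 := behead lam in
  forall k : 'I_n.+1,
    derive1n k (B k) a =
      (n`!%:R * a ^+ nth 0%N lam 0) / ((n - k)`!%:R * (b - a) ^+ k)
      * (schur1 R lam n.+1 / schur1 R lam0 n)
      * (schur2 lam0 a (n - k) b k / schur2 lam a (n.+1 - k) b k)
    /\
    derive1n (n - k) (B k) b =
      (-1) ^+ (n - k)
      * ((n`!%:R * b ^+ nth 0%N lam 0) / (k`!%:R * (b - a) ^+ (n - k)))
      * (schur1 R lam n.+1 / schur1 R lam0 n)
      * (schur2 lam0 a (n - k) b k / schur2 lam a (n - k) b k.+1).
Proof.
move=> _ lam_sorted _ a_gt0 ab cb lam0 k.
have b_gt0 : 0 < b := lt_trans a_gt0 ab.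
have a0 : a != 0 by rewrite gt_eqF.
have b0 : b != 0 by rewrite gt_eqF.
have ba0 : b - a != 0 by rewrite subr_eq0 gt_eqF.
have kn : (k <= n)%N by rewrite -ltnS.
have [p bf pB] := chebyshev_bernstein_poly a_gt0 b_gt0 cb.
pose e (j : 'I_n.+1) := muntz_exp lam j.
pose e' (j : 'I_n) := (e (lift ord0 j)).-1.
pose d := nth 0%N lam 0.
have lte (i j : 'I_n.+1) : (i < j)%N -> (e i < e j)%N by apply: muntz_exp_lt.
have e0 : e ord0 = 0%N by rewrite /e /muntz_exp subnn.
have lam_e (j : 'I_n.+1) : (nth 0 lam j + e j = d + j)%N by apply: muntz_expK.
have lam0_e (j : 'I_n) : (nth 0 lam0 j + e' j = d + j)%N.
  by rewrite /e' /e lift0; apply: muntz_exp_behead.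
have sum_lam : (\sum_(j < n.+1) nth 0 lam j = d + \sum_(j < n) nth 0 lam0 j)%N.
  by rewrite big_ord_recl; congr (_ + _)%N; apply: eq_bigr => j _; rewrite nth_behead.
have [S1'0 ES1] := rem_det_all_at_one_point lte (oner_neq0 R) e0.
rewrite -(schur1_rem_det R lam0_e) in S1'0 ES1.
rewrite -(schur1_rem_det R lam_e) in ES1.
have E0 := schur2_rem_det a0 b0 (subnK kn) lam0_e.
have u0 : b ^+ (n - k) * a ^+ k != 0 by rewrite mulf_neq0 ?expf_neq0.
split.
  rewrite (derive1n_horner_gt0 _ (pB k)) //.
  have [rho0 Ey] := bf_derivative lte k a0 b0 e0 bf.
  have w0 : (n - k)`!%:R * (b - a) ^+ k != 0 :> R.
    by rewrite mulf_neq0 ?expf_neq0 // pnatr_eq0 -lt0n fact_gt0.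
  apply: (leading_derivative_solve w0 rho0 S1'0 Ey ES1).
  apply: (schur_ratio_of_complements (s := \sum_(j < n) nth 0%N lam0 j) u0 b0 a0 rho0).
    have := schur2_rem_det a0 b0 (subnK (leqW kn)) lam_e.
    rewrite sum_lam subSn // exprS [b * a]mulrC -mulrA [b * _]mulrC.
    by rewrite [X in _ = _ * rem_det X _]mulrC.
  by rewrite [b * a]mulrC E0 [X in _ = _ * rem_det X _]mulrC.
have := bf_derivative lte (rev_ord k) b0 a0 e0 (bernstein_family_sym bf).
rewrite /= rev_ordK subSS subSn ?leq_subr // subKn // => -[rho0 Ey].
rewrite (derive1n_horner_gt0 _ (pB k)) //.
have w0 : k`!%:R * (a - b) ^+ (n - k) != 0 :> R.
  by rewrite mulf_neq0 ?expf_neq0 ?pnatr_eq0 -?lt0n ?fact_gt0 // -opprB oppr_eq0.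
(* The sign comes from (a - b) ^ (n - k), the roles of a and b being exchanged. *)
have -> : (-1) ^+ (n - k) * (n`!%:R * b ^+ d / (k`!%:R * (b - a) ^+ (n - k))) =
    n`!%:R * b ^+ d / (k`!%:R * (a - b) ^+ (n - k)).
  have -> : (a - b) ^+ (n - k) = (-1) ^+ (n - k) * (b - a) ^+ (n - k).
    by rewrite -exprMn mulN1r opprB.
  by rewrite [X in _ = _ / X]mulrCA invr_signM [RHS]mulrCA.
apply: (leading_derivative_solve w0 rho0 S1'0 Ey ES1).
apply: (schur_ratio_of_complements (s := \sum_(j < n) nth 0%N lam0 j) u0 a0 b0 rho0).
  have /(schur2_rem_det a0 b0)/(_ lam_e) : (n - k + k.+1 = n.+1)%N.
    by rewrite addnS subnK.
  by rewrite sum_lam exprSr mulrA.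
exact: E0.
Qed.
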